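(* Let $\mathcal{B}\subset\mathbb{R}^N$ be a compact polytopic set which contains the origin in its interior and satisfies $\mathcal{V}\cap\mathcal{X}^{[\mathcal{L}]}\subset\mathcal{B}$. Let $\mathcal{S}_0:=\mathcal{B}\cap\mathcal{X}^{[\mathcal{L}]}$ and $\mathcal{S}_{i+1}:=\mathcal{C}(\mathcal{S}_i)\cap\mathcal{S}_0$ for $i\ge 0$. Then there exists a finite integer $\overline{k}\geq 1$ such that $$\mathcal{S}_{\overline{k}}=\mathcal{S}_{\overline{k}+1},$$ and the maximal admissible invariant set $\mathcal{M}$ with respect to the system $x(t+1)=A_{\sigma(t)}x(t)$ and the constraints $x(t)\in\mathcal{X}$ is $\mathcal{M}=\operatorname{lower}(\mathcal{S}_{\overline{k}})$.
   Context: System. Let $\mathcal{A}=\{A_1,\dots,A_M\}\subset\mathbb{R}^{n\times n}$. The switching system is $x(t+1)=A_{\sigma(t)}x(t)$, $t\in\mathbb{N}=\{0,1,2,\dots\}$, where $x(0)\in\mathbb{R}^n$ and $\sigma:\mathbb{N}\to\{1,\dots,M\}$ is an arbitrary switching signal. Constraint set. $\mathcal{X}=\{x\in\mathbb{R}^n: c_i(x)\le 1,\ i=1,\dots,p\}$, where $c_1,\dots,c_p$ are real polynomials of maximum degree $d\ge 1$, with no constant term (all monomials have degree in $\{1,\dots,d\}$). The state constraints are $x(t)\in\mathcal{X}$ for all $t\ge 0$. Standing assumptions. (1) The system is asymptotically stable (under arbitrary switching); equivalently, the joint spectral radius $\rho(\mathcal{A})=\lim_{t\to\infty}\max\{\|A\|^{1/t}: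 A \text{ a product of } t \text{ elements of } \mathcal{A}\}$ satisfies $\rho(\mathcal{A})<1$. (2) $\mathcal{X}$ is closed, bounded and contains the origin in its interior. Invariance. A set $\mathcal{S}\subset\mathbb{R}^n$ is invariant with respect to the system if $x(0)\in\mathcal{S}$ implies $x(t)\in\mathcal{S}$ for all $t\in\mathbb{N}$ and all switching signals; it is admissible invariant if moreover $\mathcal{S}\subseteq\mathcal{X}$. The maximal admissible invariant set $\mathcal{M}$ is the admissible invariant set that contains every admissible invariant set. Lifting. For an integer $l\ge 1$, the $l$-lift $x^{[l]}\in\mathbb{R}^{\binom{n+l-1}{l}}$ of $x\in\mathbb{R}^n$ is the vector with entries $\sqrt{\alpha!}\,x^\alpha$, over all $\alpha\in\mathbb{N}^n$ with $\sum_i\alpha_i=l$ (in a fixed order), where $x^\alpha=x_1^{\alpha_1}\cdots x_n^{\alpha_n}$ and $\alpha!:=\frac{l!}{\alpha_1!\cdots\alpha_n!}$ denotes the multinomial coefficient. For $A\in\mathbb{R}^{n\times n}$, $A^{[l]}$ is the matrix of the linear map satisfying $A^{[l]}x^{[l]}=(Ax)^{[l]}$ for all $x\in\mathbb{R}^n$. Let $\mathcal{L}=\{l_1,\dots,l_K\}\subseteq\{1,\dots,d\}$ (ordered) be the set of degrees of all monomials appearing in $c_1,\dots,c_p$, and $N=\sum_{l\in\mathcal{L}}\binom{n+l-1}{l}$. Then $x^{[\mathcal{L}]}\in\mathbb{R}^N$ is obtained by stacking $x^{[l_1]},\dots,x^{[l_K]}$, and $A_i^{[\mathcal{L}]}:=\operatorname{diag}(A_i^{[l_1]},\dots,A_i^{[l_K]})$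 (block diagonal). Let $g_i\in\mathbb{R}^N$ be the vector with $c_i(x)=g_i^\top x^{[\mathcal{L}]}$ for all $x$. Define $\mathcal{X}^{[\mathcal{L}]}:=\{y\in\mathbb{R}^N: g_i^\top y\le 1,\ i=1,\dots,p\}$ and $\mathcal{V}:=\{x^{[\mathcal{L}]}: x\in\mathbb{R}^n\}\subset\mathbb{R}^N$. Maps. For $\mathcal{S}\subseteq\mathbb{R}^N$: $\operatorname{lower}(\mathcal{S}):=\{x\in\mathbb{R}^n: x^{[\mathcal{L}]}\in\mathcal{S}\}$, and the pre-image map is $\mathcal{C}(\mathcal{S}):=\{y\in\mathbb{R}^N: A_i^{[\mathcal{L}]}y\in\mathcal{S}\ \text{for all } i=1,\dots,M\}$. *)

(* Defs.v *)
From HB Require Import structures.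
From mathcomp Require Import all_boot all_order all_algebra.
From mathcomp Require Import boolp classical_sets reals topology normedtype.
From mathcomp Require Import sequences.
(* The notations of mpoly clash with those of MathComp-Analysis: below,
   [multinom n] is 'X_{1..n}, [bmultinom n b] is 'X_{1..n < b}, [mpoly n R] is
   {mpoly R[n]} and [meval v f] is f.@[v]. *)
From mathcomp Require Export -(notations) mpoly.
Import numFieldNormedType.Exports.

Set Implicit Arguments.
Unset Strict Implicit.
Unset Printing Implicit Defensive.

Import Order.TTheory GRing.Theory Num.Theory.

Local Open Scope classical_set_scope.
Local Open Scope ring_scope.

Fixpoint traj (R : realType) (n M : nat) (A : 'I_M -> 'M[R]_n)
    (sigma : nat -> 'I_M) (x0 : 'cV[R]_n) (t : nat) : 'cV[R]_n :=
  if t is t'.+1 then A (sigma t') *m traj A sigma x0 t' else x0.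

(* Lyapunov stability and attractivity of the origin; every switching signal
   is allowed, and no uniformity over signals is required of the
   convergence. *)
Definition asymptotically_stable (R : realType) (n M : nat)
    (A : 'I_M -> 'M[R]_n) : Prop :=
  (forall U : set 'cV[R]_n, nbhs (0 : 'cV[R]_n) U ->
     \forall x \near (0 : 'cV[R]_n), forall sigma t, U (traj A sigma x t)) /\
  (forall sigma x, (traj A sigma x : nat -> 'cV[R]_n) @ \oo --> (0 : 'cV[R]_n)).

Definition invariant_set (R : realType) (n M : nat) (A : 'I_M -> 'M[R]_n)
    (S : set 'cV[R]_n) : Prop :=
  forall x, S x -> forall sigma t, S (traj A sigma x t).

Definition admissible_invariant (R : realType) (n M : nat)
    (A : 'I_M -> 'M[R]_n) (X S : set 'cV[R]_n) : Prop :=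
  invariant_set A S /\ S `<=` X.

Definition max_admissible_invariant (R : realType) (n M : nat)
    (A : 'I_M -> 'M[R]_n) (X S : set 'cV[R]_n) : Prop :=
  admissible_invariant A X S /\
  forall T, admissible_invariant A X T -> T `<=` S.

Definition constraint_set (R : realType) (n p : nat) (c : 'I_p -> mpoly n R) :
    set 'cV[R]_n :=
  [set x | forall i, meval (fun j => x j 0) (c i) <= 1].

Definition degrees (R : realType) (n p : nat) (c : 'I_p -> mpoly n R) :
    seq nat :=
  sort leq (undup [seq mdeg m | i <- enum 'I_p, m <- msupp (c i)]).

Definition monom (n l : nat) := {m : bmultinom n l.+1 | mdeg m == l}.

(* The order of the coordinates of an l-lift is that of [enum (monom n l)]. *)
Definition hlift_dim (n l : nat) : nat := #|{: monom n l}|.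

Definition monom_of (n l : nat) (k : 'I_(hlift_dim n l)) : multinom n :=
  val (val (enum_val k)).

Definition mpower (R : realType) (n : nat) (x : 'cV[R]_n) (m : multinom n) : R :=
  \prod_(i < n) x i 0 ^+ m i.

Definition multinomial (R : realType) (n : nat) (m : multinom n) : R :=
  (mdeg m)`!%:R / (\prod_(i < n) (m i)`!)%:R.

Definition hlift (R : realType) (n l : nat) (x : 'cV[R]_n) :
    'cV[R]_(hlift_dim n l) :=
  \col_k (Num.sqrt (multinomial R (monom_of k)) * mpower x (monom_of k)).

(* Characterized by [hliftmxP] and [hliftmx_unique]. *)
Definition hliftmx (R : realType) (n l : nat) (A : 'M[R]_n) :
    'M[R]_(hlift_dim n l) :=
  xget 0 [set B | forall x : 'cV[R]_n, B *m hlift l x = hlift l (A *m x)].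

Definition lift_dim (n : nat) (L : seq nat) : nat :=
  (\sum_(k < size L) hlift_dim n (nth 0 L k))%N.

Definition mlift (R : realType) (n : nat) (L : seq nat) (x : 'cV[R]_n) :
    'cV[R]_(lift_dim n L) :=
  \mxcol_(k < size L) hlift (nth 0%N L k) x.

Definition liftmx (R : realType) (n : nat) (L : seq nat) (A : 'M[R]_n) :
    'M[R]_(lift_dim n L) :=
  \mxdiag_(k < size L) hliftmx (nth 0%N L k) A.

(* Characterized by [coef_vecP] and [coef_vec_unique]. *)
Definition coef_vec (R : realType) (n : nat) (L : seq nat) (f : mpoly n R) :
    'cV[R]_(lift_dim n L) :=
  xget 0 [set g | forall x : 'cV[R]_n,
            meval (fun j => x j 0) f = (g^T *m mlift L x) 0 0].

Definition lifted_constraint_set (R : realType) (n p : nat)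
    (c : 'I_p -> mpoly n R) : set 'cV[R]_(lift_dim n (degrees c)) :=
  [set y | forall i, ((coef_vec (degrees c) (c i))^T *m y) 0 0 <= 1].
Arguments lifted_constraint_set {R n p} c.

Definition lift_variety (R : realType) (n : nat) (L : seq nat) :
    set 'cV[R]_(lift_dim n L) :=
  range (@mlift R n L).
Arguments lift_variety R n L : clear implicits.

Definition lower (R : realType) (n : nat) (L : seq nat)
    (S : set 'cV[R]_(lift_dim n L)) : set 'cV[R]_n :=
  [set x | S (mlift L x)].

Definition preimage_map (R : realType) (n M : nat) (L : seq nat)
    (A : 'I_M -> 'M[R]_n) (S : set 'cV[R]_(lift_dim n L)) :
    set 'cV[R]_(lift_dim n L) :=
  [set y | forall i, S (liftmx L (A i) *m y)].

Fixpoint backward_iter (R : realType) (n M : nat) (L : seq nat)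
    (A : 'I_M -> 'M[R]_n) (S0 : set 'cV[R]_(lift_dim n L)) (k : nat) :
    set 'cV[R]_(lift_dim n L) :=
  if k is k'.+1 then preimage_map A (backward_iter A S0 k') `&` S0 else S0.

(* An intersection of finitely many closed half-spaces. *)
Definition polytopic (R : realType) (N : nat) (B : set 'cV[R]_N) : Prop :=
  exists (q : nat) (H : 'M[R]_(q, N)) (b : 'cV[R]_q),
    B = [set y | forall i, (H *m y) i 0 <= b i 0].

Definition monoms (n l : nat) : seq (multinom n) :=
  [seq val (val m) | m <- enum {: monom n l}].

Lemma mem_monoms n l (m : multinom n) : (m \in monoms n l) = (mdeg m == l).
Proof.
apply/mapP/idP => [[u _ ->]|ml]; first exact: (valP u).
have mb : (mdeg m < l.+1)%N by rewrite (eqP ml).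
by exists (exist _ (BMultinom mb) ml : monom n l); rewrite ?mem_enum.
Qed.

Lemma monoms_uniq n l : uniq (monoms n l).
Proof.
rewrite map_inj_uniq ?enum_uniq// => a b /val_inj/val_inj; exact.
Qed.

Lemma size_monoms n l : size (monoms n l) = hlift_dim n l.
Proof. by rewrite size_map -cardE. Qed.

Lemma hlift_dimE n l : (0 < l)%N -> hlift_dim n l = 'C((n + l).-1, l).
Proof.
move=> l0; rewrite -size_monoms.
have -> : size (monoms n l) =
    size [seq s2m t | t : l.-tuple 'I_n <- enum (basis n l)].
  apply/perm_size/uniq_perm; rewrite ?monoms_uniq ?uniq_basis// => m.
  by rewrite mem_monoms basis_cover.
case: n => [|n]; last by rewrite size_basis addSn addnC.
rewrite add0n bin_small ?prednK//.
case E : [seq _ | _ <- _] => [//|m s].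
have : m \in m :: s by rewrite mem_head.
by rewrite -E -basis_cover mdegE big_ord0 => /eqP l00; rewrite -l00 in l0.
Qed.

Lemma sum_monom_of (R : realType) n l (F : multinom n -> R) :
  \sum_(k < hlift_dim n l) F (monom_of k) = \sum_(m <- monoms n l) F m.
Proof.
rewrite big_map big_enum /=.
by rewrite (big_enum_val (A := {: monom n l}) (fun u => F (val (val u)))).
Qed.

Lemma sum_monoms_supp (R : realType) n l (f : mpoly n R)
    (F : multinom n -> R) :
  \sum_(m <- monoms n l) mcoeff m f * F m =
  \sum_(m <- msupp f | mdeg m == l) mcoeff m f * F m.
Proof.
rewrite (bigID (fun m => m \in msupp f)) /= [X in _ + X]big1 ?addr0; last first.
  by move=> m mf; rewrite memN_msupp_eq0// mul0r.
rewrite -big_filter -[RHS]big_filter; apply/perm_big/uniq_perm.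
- by rewrite filter_uniq ?monoms_uniq.
- by rewrite filter_uniq ?msupp_uniq.
- by move=> m; rewrite !mem_filter mem_monoms andbC.
Qed.

Lemma multinomial_gt0 (R : realType) n (m : multinom n) : 0 < multinomial R m.
Proof.
rewrite divr_gt0// ltr0n ?fact_gt0//.
by apply: prodn_gt0 => i; rewrite fact_gt0.
Qed.

Lemma sqrt_multinomial_neq0 (R : realType) n (m : multinom n) :
  Num.sqrt (multinomial R m) != 0.
Proof. by rewrite gt_eqF// sqrtr_gt0 multinomial_gt0. Qed.

(* A polynomial vanishing identically is zero: substitute the powers of a
   single variable s to the D^i, with D larger than all exponents. *)
Lemma digits_inj n D (f g : 'I_n -> nat) :
  (forall i, f i < D)%N -> (forall i, g i < D)%N ->
  (\sum_i f i * D ^ i = \sum_i g i * D ^ i)%N -> f =1 g.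
Proof.
elim: n f g => [|n IH] f g fD gD; first by move=> _ [].
have D0 : (0 < D)%N := leq_ltn_trans (leq0n _) (fD ord0).
have E h : (\sum_(i < n.+1) h i * D ^ i =
    (\sum_(i < n) h (fintype.lift ord0 i) * D ^ i) * D + h ord0)%N.
  rewrite big_ord_recl /= muln1 addnC big_distrl /=; congr (_ + _)%N.
  by apply: eq_bigr => i _; rewrite /bump /= expnS -mulnA (mulnC D).
rewrite !E => H.
have H0 : f ord0 = g ord0.
  by have := congr1 (modn^~ D) H; rewrite !modnMDl !modn_small.
move: H; rewrite H0 => /addIn /eqP; rewrite eqn_pmul2r// => /eqP H.
have IHfg := IH _ _ (fun i => fD _) (fun i => gD _) H.
by move=> i; case: (unliftP ord0 i) => [j ->|->//]; exact: IHfg.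
Qed.

Lemma poly_fun_eq0 (R : realType) (q : {poly R}) :
  (forall s, q.[s] = 0) -> q = 0.
Proof.
move=> q0; apply/eqP; apply: contraT => qn0.
have := @max_poly_roots _ q [seq k%:R | k <- iota 0 (size q)] qn0.
rewrite size_map size_iota ltnn; apply.
  by apply/allP => s _; rewrite rootE q0.
by rewrite map_inj_uniq ?iota_uniq//; exact: mulrIn (oner_neq0 _).
Qed.

Lemma mpoly_fun_eq0 (R : realType) n (f : mpoly n R) :
  (forall v, meval v f = 0) -> f = 0.
Proof.
move=> f0; pose D := (mmeasure mdeg f).
have mD m i : m \in msupp f -> (m i < D)%N.
  move=> /msize_mdeg_lt; apply: leq_ltn_trans.
  by rewrite mdegE (bigD1 i)//= leq_addr.
pose e (m : multinom n) := (\sum_i m i * D ^ i)%N.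
pose q : {poly R} := \sum_(m <- msupp f) mcoeff m f *: 'X^(e m).
have q0 : q = 0.
  apply: poly_fun_eq0 => s; rewrite -[RHS](f0 (fun i => s ^+ (D ^ i))).
  rewrite mevalE horner_sum; apply: eq_bigr => m _.
  rewrite hornerZ hornerXn -prodrXr; congr (_ * _); apply: eq_bigr => i _.
  by rewrite -exprM mulnC.
apply/mpolyP => m; rewrite mcoeff0.
have [mf|mf] := boolP (m \in msupp f); last by rewrite memN_msupp_eq0.
have := congr1 (fun q : {poly R} => q`_(e m)) q0; rewrite coef0 coef_sum.
rewrite (bigD1_seq m) ?msupp_uniq//= coefZ coefXn eqxx mulr1.
rewrite big_seq_cond big1 ?addr0// => m' /andP[m'f m'm].
rewrite coefZ coefXn; case: eqP => [em|]; last by rewrite mulr0.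
case/eqP: m'm; apply/mnmP => i; symmetry.
by apply: (@digits_inj n D) => // j; exact: mD.
Qed.

Lemma monom_of_inj n l : injective (@monom_of n l).
Proof. by move=> i j /val_inj/val_inj/enum_val_inj. Qed.

Lemma mdeg_monom_of n l (k : 'I_(hlift_dim n l)) : mdeg (monom_of k) = l.
Proof. exact/eqP/(valP (enum_val k)). Qed.

Definition form_of (R : realType) n l (u : 'rV[R]_(hlift_dim n l)) :
    mpoly n R :=
  \sum_k (u 0 k * Num.sqrt (multinomial R (monom_of k))) *:
         mpolyX R (monom_of k).

Lemma form_ofE (R : realType) n l (u : 'rV[R]_(hlift_dim n l))
    (v : 'I_n -> R) :
  meval v (form_of u) = (u *m hlift l (\col_j v j)) 0 0.
Proof.
rewrite raddf_sum mxE; apply: eq_bigr => k _.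
rewrite /= mevalZ mevalX !mxE -mulrA /mpower; congr (_ * (_ * _)).
by apply: eq_bigr => i _; rewrite mxE.
Qed.

Lemma mcoeff_form_of (R : realType) n l (u : 'rV[R]_(hlift_dim n l)) k :
  mcoeff (monom_of k) (form_of u) =
  u 0 k * Num.sqrt (multinomial R (monom_of k)).
Proof.
rewrite raddf_sum (bigD1 k)//= mcoeffZ mcoeffX eqxx mulr1 big1 ?addr0// => j jk.
by rewrite mcoeffZ mcoeffX (inj_eq (@monom_of_inj _ _)) (negbTE jk) mulr0.
Qed.

Lemma mcoeff_form_of0 (R : realType) n l (u : 'rV[R]_(hlift_dim n l)) m :
  mdeg m != l -> mcoeff m (form_of u) = 0.
Proof.
move=> ml; rewrite raddf_sum big1// => k _ /=; rewrite mcoeffZ mcoeffX.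
by case: eqP => [km|]; rewrite ?mulr0// -km mdeg_monom_of eqxx in ml *.
Qed.

Lemma lift_span (R : realType) n L (u : 'rV[R]_(lift_dim n L)) : uniq L ->
  (forall x : 'cV[R]_n, u *m mlift L x = 0) -> u = 0.
Proof.
move=> Lu u0.
pose f := \sum_(k < size L) form_of (submxrow u k).
have f0 : f = 0.
  apply: mpoly_fun_eq0 => v; rewrite raddf_sum /=.
  have := congr1 (fun A : 'M[R]_1 => A 0 0) (u0 (\col_j v j)).
  rewrite -{1}[u]submxrowK /mlift mul_mxrow_mxcol summxE mxE => {2}<-.
  by apply: eq_bigr => k _; rewrite form_ofE.
rewrite -[u]submxrowK -[RHS]submxrowK; apply: eq_mxrow => k; apply/rowP => i.
have := congr1 (mcoeff (monom_of i)) f0; rewrite mcoeff0 raddf_sum.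
rewrite (bigD1 k)//= mcoeff_form_of big1 ?addr0 => [/eqP|j jk]; last first.
  rewrite mcoeff_form_of0// mdeg_monom_of.
  by rewrite (nth_uniq 0%N) ?ltn_ord// -(inj_eq val_inj) eq_sym in jk *.
rewrite mulf_eq0 (negbTE (sqrt_multinomial_neq0 _ _)) orbF => /eqP ->.
by rewrite !mxE.
Qed.

Lemma hlift_span (R : realType) n l (u : 'rV[R]_(hlift_dim n l)) :
  (forall x : 'cV[R]_n, u *m hlift l x = 0) -> u = 0.
Proof.
move=> u0; have f0 : form_of u = 0.
  by apply: mpoly_fun_eq0 => v; rewrite form_ofE u0 mxE.
apply/rowP => i; have := congr1 (mcoeff (monom_of i)) f0.
rewrite mcoeff0 mcoeff_form_of => /eqP.
by rewrite mulf_eq0 (negbTE (sqrt_multinomial_neq0 _ _)) orbF mxE => /eqP.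
Qed.

Lemma meval_hlift (R : realType) n l (f : mpoly n R) (x : 'cV[R]_n) :
  ((\row_k (mcoeff (monom_of k) f / Num.sqrt (multinomial R (monom_of k))))
     *m hlift l x) 0 0 =
  \sum_(m <- msupp f | mdeg m == l) mcoeff m f * mpower x m.
Proof.
rewrite -sum_monoms_supp -sum_monom_of mxE; apply: eq_bigr => k _.
by rewrite !mxE mulrA divfK// sqrt_multinomial_neq0.
Qed.

Lemma hliftmxP (R : realType) n l (A : 'M[R]_n) (x : 'cV[R]_n) :
  hliftmx l A *m hlift l x = hlift l (A *m x).
Proof.
move: x; suff : exists B : 'M[R]_(hlift_dim n l), forall x : 'cV[R]_n,
    B *m hlift l x = hlift l (A *m x) by exact: xgetPex.
pose q (m : multinom n) : mpoly n R :=
  \prod_(i < n) (\sum_(j < n) A i j *: mpolyX R (mnm1 j)) ^+ m i.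
have qE (x : 'cV[R]_n) m : meval (fun j => x j 0) (q m) = mpower (A *m x) m.
  rewrite rmorph_prod; apply: eq_bigr => i _; rewrite rmorphXn /=.
  rewrite raddf_sum mxE; congr (_ ^+ _); apply: eq_bigr => j _ /=.
  by rewrite mevalZ mevalXU.
have q_homog m : q m \is ishomog1 (mdeg m) mdeg.
  rewrite /q mdegE; apply: (big_ind2 (fun p e => p \is ishomog1 e mdeg)).
  - exact: dhomog1.
  - by move=> ? ? ? ?; exact: dhomogM.
  - move=> i _; rewrite -[X in ishomog1 X _]mul1n; apply: dhomogMn.
    by apply: rpred_sum => j _; apply: dhomogZ; rewrite dhomogX; apply/eqP; exact: mdeg1.
pose B : 'M[R]_(hlift_dim n l) := \matrix_(r, k)
  (Num.sqrt (multinomial R (monom_of r)) * (mcoeff (monom_of k) (q (monom_of r))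
     / Num.sqrt (multinomial R (monom_of k)))).
exists B => x; apply/colP => r; rewrite [RHS]mxE -qE mevalE.
transitivity (Num.sqrt (multinomial R (monom_of r)) *
   (\sum_(m <- msupp (q (monom_of r)) | mdeg m == l)
      mcoeff m (q (monom_of r)) * mpower x m)).
  rewrite -meval_hlift !mxE big_distrr /=; apply: eq_bigr => k _.
  by rewrite !mxE !mulrA.
congr (_ * _); rewrite big_seq_cond [RHS]big_seq; apply: eq_bigl => m.
case mq : (m \in _) => //=.
by rewrite (dhomog_mf (q_homog _) mq) mdeg_monom_of eqxx.
Qed.

Lemma hliftmx_unique (R : realType) n l (A : 'M[R]_n) B :
  (forall x : 'cV[R]_n, B *m hlift l x = hlift l (A *m x)) ->
  B = hliftmx l A.
Proof.
move=> BP; apply/eqP; rewrite -subr_eq0; apply/eqP/row_matrixP => i.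
rewrite row0; apply: hlift_span => x.
by rewrite -row_mul mulmxBl BP hliftmxP subrr row0.
Qed.

Lemma liftmxP (R : realType) n L (A : 'M[R]_n) (x : 'cV[R]_n) :
  liftmx L A *m mlift L x = mlift L (A *m x).
Proof.
rewrite /liftmx /mlift mul_mxdiag_mxcol; apply: eq_mxcol => k.
exact: hliftmxP.
Qed.

Lemma coef_vecP (R : realType) n L (f : mpoly n R) (x : 'cV[R]_n) : uniq L ->
  (forall m, m \in msupp f -> mdeg m \in L) ->
  meval (fun j => x j 0) f = ((coef_vec L f)^T *m mlift L x) 0 0.
Proof.
move=> Lu fL; move: x; suff : exists g : 'cV[R]_(lift_dim n L), forall x : 'cV[R]_n,
    meval (fun j => x j 0) f = (g^T *m mlift L x) 0 0 by exact: xgetPex.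
exists (\mxcol_(k < size L) \col_i (mcoeff (monom_of i) f
   / Num.sqrt (multinomial R (monom_of i)))) => x.
rewrite tr_mxcol /mlift mul_mxrow_mxcol summxE mevalE.
transitivity (\sum_(k < size L)
    \sum_(m <- msupp f | mdeg m == nth 0%N L k) mcoeff m f * mpower x m).
  rewrite -(big_mkord xpredT (fun k =>
    \sum_(m <- msupp f | mdeg m == nth 0%N L k) mcoeff m f * mpower x m)).
  rewrite -(big_nth 0%N xpredT (fun l =>
    \sum_(m <- msupp f | mdeg m == l) mcoeff m f * mpower x m)).
  rewrite (exchange_big_dep predT)//= big_seq [RHS]big_seq.
  apply: eq_bigr => m /fL mL.
  rewrite (eq_bigl (pred1 (mdeg m))); last by move=> l; exact: eq_sym.
  by rewrite -[RHS]big_filter filter_pred1_uniq// big_seq1.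
apply: eq_bigr => k _; rewrite -meval_hlift; congr ((_ *m _) 0 0).
by apply/rowP => i; rewrite !mxE.
Qed.

Lemma coef_vec_unique (R : realType) n L (f : mpoly n R) g : uniq L ->
  (forall x : 'cV[R]_n, meval (fun j => x j 0) f = (g^T *m mlift L x) 0 0) ->
  g = coef_vec L f.
Proof.
move=> Lu gP; apply/trmx_inj/eqP; rewrite -subr_eq0; apply/eqP.
apply: (lift_span Lu) => x; apply/matrixP => i j; rewrite !ord1 mulmxBl !mxE.
have := @xgetI _ 0 [set g | forall x : 'cV[R]_n,
  meval (fun j => x j 0) f = (g^T *m mlift L x) 0 0] g gP x.
rewrite -/(coef_vec L f) gP !mxE => ->; exact: subrr.
Qed.

Lemma degrees_uniq (R : realType) n p (c : 'I_p -> mpoly n R) :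
  uniq (degrees c).
Proof. by rewrite sort_uniq undup_uniq. Qed.

Lemma mem_degrees (R : realType) n p (c : 'I_p -> mpoly n R) l :
  reflect (exists i m, m \in msupp (c i) /\ mdeg m = l) (l \in degrees c).
Proof.
rewrite mem_sort mem_undup; apply: (iffP allpairsPdep).
  by move=> [i [m [_ mc ->]]]; exists i, m.
by move=> [i [m [mc <-]]]; exists i, m; rewrite mem_enum.
Qed.

(* Main.v *)
Require Import Defs.
From mathcomp Require Import all_boot all_order all_algebra.
From mathcomp Require Import boolp classical_sets reals topology normedtype.
From mathcomp Require Import lra.
Import numFieldNormedType.Exports.
Import Order.TTheory GRing.Theory Num.Theory.
Set Implicit Arguments.
Unset Strict Implicit.
Unset Printing Implicit Defensive.
Local Open Scope classical_set_scope.
Local Open Scope ring_scope.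

(** The lift intertwines the two systems: the lifted trajectory of
    [mlift L x] is the lift of the trajectory of [x].  Unfolding the recursion,
    [S k] is the set of the lifted states all of whose trajectories stay in
    [S 0] up to time [k] ([backward_iterP]).

    Finite termination: [S 0] is bounded and is a neighbourhood of the origin,
    so it is enough that the lifted system contracts, uniformly over the
    switching signals, any bounded set into any neighbourhood of 0 after some
    time [T].  Staying in [S 0] up to time [T] then implies staying there for
    ever, and the sets [S k] are constant from there on.

    The uniform contraction is obtained without any matrix norm estimate or
    joint spectral radius:
    - asymptotic stability only gives convergence signal by signal, but
      stability, finiteness of the set of modes and Konig's lemma make the
      convergence from each single state uniform
      ([asymptotically_stable_uniform]);
    - the lift is small near the origin because no degree is 0, hence lifted
      points are uniformly attracted by the lifted system;
    - uniformly attracted states form a linear subspace, and the lifted points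
      span the whole lifted space because a polynomial vanishing everywhere is
      zero ([lift_span]); hence every state of the lifted system is uniformly
      attracted ([lift_uniformly_attracted]);
    - decomposing on the canonical basis, the attraction is uniform on bounded
      sets ([uniform_absorption]).

    Maximality: when [S k = S k.+1], the set [S k] is invariant for the lifted
    modes, so that [lower (S k)] is invariant, and it lies in the constraint
    set.  Conversely, along a trajectory that stays admissible the lifted
    points are in the lifted constraint set, hence in [B], so they never leave
    [S 0] ([backward_iter_max_invariant]). *)

(** * Trajectories *)

Lemma trajD (R : realType) (n M : nat) (A : 'I_M -> 'M[R]_n) sigma x s t :
  traj A sigma x (t + s) =
  traj A (fun k => sigma (k + s)%N) (traj A sigma x s) t.
Proof. by elim: t => //= t ->. Qed.

Lemma trajSr (R : realType) (n M : nat) (A : 'I_M -> 'M[R]_n) sigma x t :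
  traj A sigma x t.+1 =
  traj A (fun k => sigma k.+1) (A (sigma 0%N) *m x) t.
Proof.
have := trajD A sigma x 1 t; rewrite addn1 => ->; congr (traj A _ _ t).
by apply/funext => k; rewrite addn1.
Qed.

(** For a fixed signal and a fixed time the flow is a matrix product; this
    gives the linearity of trajectories in the initial state. *)
Lemma traj_mulmx (R : realType) (n M : nat) (A : 'I_M -> 'M[R]_n) sigma t :
  exists P : 'M[R]_n, forall x, traj A sigma x t = P *m x.
Proof.
elim: t => [|t [P PE]]; first by exists 1%:M => x; rewrite mul1mx.
by exists (A (sigma t) *m P) => x; rewrite /= PE mulmxA.
Qed.

Lemma traj_mlift (R : realType) (n M : nat) (L : seq nat)
    (A : 'I_M -> 'M[R]_n) sigma x t :
  traj (fun i => liftmx L (A i)) sigma (mlift L x) t =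
  mlift L (traj A sigma x t).
Proof. by elim: t => //= t ->; rewrite liftmxP. Qed.

(** * Uniform attraction *)

Definition uniformly_attracted (R : realType) (n M : nat)
    (A : 'I_M -> 'M[R]_n) (x : 'cV[R]_n) : Prop :=
  forall e, 0 < e -> exists T, forall sigma t, (T <= t)%N ->
    `|traj A sigma x t| < e.

(** Konig's lemma.  By stability, a trajectory that has entered a small ball
    of radius [d] stays within [e] from then on.  If the convergence from [x]
    were not uniform, there would be arbitrarily long signals keeping the
    trajectory outside of the [d]-ball; as there are finitely many modes, one
    of them leads to a state with the same property, and iterating yields one
    infinite signal along which the trajectory never enters the ball, against
    attractivity. *)
Lemma asymptotically_stable_uniform (R : realType) (n M : nat)
    (A : 'I_M -> 'M[R]_n) x :
  asymptotically_stable A -> uniformly_attracted A x.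
Proof.
move=> [stable attractive] e e0.
have /stable/nbhs_norm0P[d /= d0 dP] : \forall y \near (0 : 'cV[R]_n), `|y| < e.
  by apply/nbhs_norm0P; exists e.
pose far y T := exists sigma, forall t, (t <= T)%N -> d <= `|traj A sigma y t|.
have [[T nfar]|nofar] := pselect (exists T, ~ far x T).
  exists T => sigma t Tt; apply/negP => /negP; rewrite -leNgt => et.
  (* Entering the [d]-ball at a time [s <= T] would keep the trajectory below
     [e] at time [t]. *)
  apply: nfar; exists sigma => s sT; rewrite leNgt; apply/negP => /dP small.
  have := small (fun k => sigma (k + s)%N) (t - s)%N.
  rewrite -trajD subnK ?(leq_trans sT)//= => /lt_le_trans/(_ et).
  by rewrite ltxx.
pose never y := forall T, far y T.
have never_step y : never y -> exists i, never (A i *m y).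
  move=> neary; apply: contrapT => nostep.
  have /choice[T TP] : forall i, exists T, ~ far (A i *m y) T.
    by move=> i; apply/existsNP => fari; apply: nostep; exists i.
  (* A signal that works for longer than all the times [T i] contradicts the
     bound attached to its own first mode. *)
  have [sigma farsigma] := neary (\max_i T i).+1.
  apply: (TP (sigma 0%N)); exists (fun k => sigma k.+1) => t tT.
  rewrite -trajSr; apply: farsigma; rewrite ltnS (leq_trans tT)//.
  exact: leq_bigmax.
have neverx : never x by move=> T; apply: contrapT => ?; apply: nofar; exists T.
(* A signal exists, so there is a mode [sigma0 0] to use as a default choice. *)
have [sigma0 _] := neverx 0%N.
have /choice[f fP] : forall y, exists i, never y -> never (A i *m y).
  move=> y; have [/never_step[i ?]|?] := pselect (never y); first by exists i.
  by exists (sigma0 0%N).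
pose y k := iter k (fun y => A (f y) *m y) x.
(* The feedback [f] generates an infinite signal [f \o y]. *)
have trajy k : traj A (f \o y) x k = y k by elim: k => //= k ->.
have nevery k : never (y k) by elim: k => //= k; exact: fP.
have /cvgr0Pnorm_lt/(_ d d0)[T _ /(_ T (leqnn T))] := attractive (f \o y) x.
have [tau /(_ 0%N (leqnn _))/= dy] := nevery T 0%N.
by rewrite /= trajy ltNge dy.
Qed.

Lemma uniformly_attracted0 (R : realType) (n M : nat) (A : 'I_M -> 'M[R]_n) :
  uniformly_attracted A 0.
Proof.
move=> e e0; exists 0%N => sigma t _.
by have [P ->] := traj_mulmx A sigma t; rewrite mulmx0 normr0.
Qed.

Lemma uniformly_attracted_lin (R : realType) (n M : nat) (A : 'I_M -> 'M[R]_n)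
    a x y :
  uniformly_attracted A x -> uniformly_attracted A y ->
  uniformly_attracted A (a *: x + y).
Proof.
move=> xP yP e e0; have a0 : 0 < `|a| + 1 by rewrite ltr_wpDl.
have [Tx TxP] := xP _ (divr_gt0 (divr_gt0 e0 (ltr0n R 2)) a0).
have [Ty TyP] := yP _ (divr_gt0 e0 (ltr0n R 2)).
exists (maxn Tx Ty) => sigma t; rewrite geq_max => /andP[/TxP + /TyP].
move=> /(_ sigma) + /(_ sigma); have [P PE] := traj_mulmx A sigma t.
rewrite !PE mulmxDr -scalemxAr ltr_pdivlMr// => xt yt.
apply: (le_lt_trans (ler_normD _ _)); rewrite normrZ.
have := normr_ge0 (P *m x); nra.
Qed.

(** A subspace separated by no nonzero linear form is everything.  The
    subspace is given by a mere predicate, so it is compared with the row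
    space of a matrix [W] of maximal rank among those whose row space it
    contains: by maximality [W] spans it all, the columns of [cokermx W] are
    then forms vanishing on it, hence [cokermx W = 0] and [W] has full rank. *)
Lemma subspace_full (F : fieldType) (N : nat) (P : 'cV[F]_N -> Prop) :
  P 0 -> (forall a u v, P u -> P v -> P (a *: u + v)) ->
  (forall w : 'rV[F]_N, (forall y, P y -> w *m y = 0) -> w = 0) ->
  forall y, P y.
Proof.
move=> P0 Plin Psep.
pose inP (W : 'M[F]_N) := forall v : 'rV[F]_N, (v <= W)%MS -> P v^T.
pose Q r := `[< exists W, \rank W = r /\ inP W >].
have exQ : exists r, Q r.
  exists (\rank (0 : 'M[F]_N)); apply/asboolP; exists 0; split=> // v.
  by rewrite submx0 => /eqP ->; rewrite trmx0.
have ubQ r : Q r -> (r <= N)%N by move=> /asboolP[W [<- _]]; exact: rank_leq_row.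
case: (ex_maxnP exQ ubQ) => r /asboolP[W [rW WP]] rmax.
have PW y : P y -> (y^T <= W)%MS.
  move=> Py; apply: contraT => yW.
  have /rmax : Q (\rank (W + y^T)%MS).
    apply/asboolP; exists (W + y^T)%MS; split=> // v.
    move=> /sub_addsmxP[[a b] /= ->].
    rewrite [b]mx11_scalar mul_scalar_mx addrC linearD linearZ /= trmxK.
    by apply: Plin => //; apply: WP; exact: submxMl.
  rewrite leqNgt -rW rank_ltmx// ltmxE addsmxSl /=.
  by apply: contra yW; apply: submx_trans; exact: addsmxSr.
have W0 : cokermx W = 0.
  apply/trmx_inj/row_matrixP => i; rewrite trmx0 row0; apply: Psep => y /PW.
  rewrite submxE => /eqP yW; rewrite -row_mul -[y]trmxK -trmx_mul yW.
  by rewrite trmx0 row0.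
by move=> y; rewrite -[y]trmxK; apply: WP; rewrite submxE W0 mulmx0.
Qed.

(** By linearity the trajectory of [x] is the combination, with coefficients
    bounded by [K], of the [n] trajectories of the canonical basis vectors;
    the times after which each of these is small enough are finitely many. *)
Lemma uniform_absorption (R : realType) (n M : nat) (A : 'I_M -> 'M[R]_n)
    (K : R) (U : set 'cV[R]_n) :
  (forall x, uniformly_attracted A x) -> nbhs (0 : 'cV[R]_n) U ->
  exists T, forall x sigma t, `|x| <= K -> (T <= t)%N -> U (traj A sigma x t).
Proof.
move=> attr /nbhs_norm0P[e /= e0 eU].
have c0 : 0 < n%:R * `|K| + 1 :> R by rewrite ltr_wpDl// mulr_ge0.
have /choice[T TP] := fun j : 'I_n =>
  attr (delta_mx j 0) (e / (n%:R * `|K| + 1)) (divr_gt0 e0 c0).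
exists (\max_j T j)%N => x sigma t xK tT; apply: eU => /=.
have [P PE] := traj_mulmx A sigma t.
have -> : traj A sigma x t =
    \sum_j x j 0 *: traj A sigma (delta_mx j 0) t.
  rewrite PE {1}[x]matrix_sum_delta mulmx_sumr; apply: eq_bigr => j _.
  by rewrite big_ord1 -scalemxAr PE.
apply: (@le_lt_trans _ _ (\sum_(j < n) `|K| * (e / (n%:R * `|K| + 1)))).
  apply: (le_trans (ler_norm_sum _ _ _)); apply: ler_sum => j _.
  rewrite normrZ ler_pM//.
    apply: le_trans (le_trans xK (ler_norm K)).
    rewrite [leRHS]mx_normrE; exact: (le_bigmax _ _ (j, 0)).
  by apply/ltW/TP/(leq_trans _ tT)/leq_bigmax.
rewrite sumr_const card_ord -[ltLHS]mulr_natl !mulrA ltr_pdivrMr//.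
have := mulr_ge0 (ler0n R n) (normr_ge0 K); nra.
Qed.

(** * The lift near the origin *)

(** One of the factors of the monomial is at most [|x|], the others at most
    1. *)
Lemma mpower_le (R : realType) (n : nat) (x : 'cV[R]_n) (m : multinom n) :
  (0 < mdeg m)%N -> `|x| <= 1 -> `|mpower x m| <= `|x|.
Proof.
move=> m0 x1; have xi i : `|x i 0| <= `|x|.
  by rewrite [leRHS]mx_normrE; exact: (le_bigmax _ _ (i, 0)).
have [i mi] : exists i, (0 < m i)%N.
  apply/existsP; apply: contraLR m0 => /existsPn m0.
  by rewrite mdegE big1// => i _; apply/eqP; rewrite eqn0Ngt m0.
rewrite /mpower normr_prod (bigD1 i)//= normrX -(prednK mi) exprS.
rewrite -mulrA -[leRHS]mulr1 ler_pM ?mulr_ge0 ?exprn_ge0 ?prodr_ge0//.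
rewrite mulr_ile1 ?exprn_ge0 ?prodr_ge0 ?exprn_ile1 ?(le_trans (xi i))//.
apply: prodr_ile1 => j _; rewrite normrX exprn_ge0//=.
by rewrite exprn_ile1// (le_trans (xi j)).
Qed.

Lemma mlift_near0 (R : realType) (n : nat) (L : seq nat) (e : R) :
  0%N \notin L -> 0 < e ->
  exists2 d, 0 < d & forall x : 'cV[R]_n, `|x| < d -> `|mlift L x| < e.
Proof.
move=> L0 e0.
have /choice[s sP] : forall i, exists s, forall x : 'cV[R]_n,
    `|x| <= 1 -> `|mlift L x i 0| <= s * `|x|.
  move=> i; pose m := monom_of (tagnat.sig2 i).
  exists (Num.sqrt (multinomial R m)) => x x1.
  rewrite !mxE normrM ger0_norm ?sqrtr_ge0// ler_wpM2l ?sqrtr_ge0//.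
  rewrite mpower_le// mdeg_monom_of lt0n; apply: contra L0 => /eqP <-.
  exact: mem_nth.
pose C := \sum_i `|s i| + 1.
have C0 : 0 < C by rewrite ltr_wpDl// sumr_ge0.
exists (Num.min 1 (e / C)); first by rewrite lt_min ltr01 divr_gt0.
move=> x; rewrite lt_min => /andP[/ltW x1]; rewrite ltr_pdivlMr// => xe.
rewrite [ltLHS]mx_normrE; apply: bigmax_lt => //= -[i j] _ /=; rewrite ord1.
apply: (le_lt_trans (sP i x x1)); apply: le_lt_trans xe.
rewrite mulrC ler_wpM2l// (le_trans (ler_norm _))//.
by rewrite /C (bigD1 i)//= -addrA lerDl addr_ge0// sumr_ge0.
Qed.

(** Attraction transfers from [x] to [mlift L x] since lifted trajectories of
    lifted points are lifts; it extends to the other states by linearity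
    because lifted points span. *)
Lemma lift_uniformly_attracted (R : realType) (n M : nat) (L : seq nat)
    (A : 'I_M -> 'M[R]_n) :
  uniq L -> 0%N \notin L -> (forall x, uniformly_attracted A x) ->
  forall y, uniformly_attracted (fun i => liftmx L (A i)) y.
Proof.
move=> Lu L0 attr; apply: subspace_full.
- exact: uniformly_attracted0.
- by move=> a u v; exact: uniformly_attracted_lin.
- move=> w wP; apply: (lift_span Lu) => x; apply: wP => e e0.
  have [d d0 dP] := @mlift_near0 R n L e L0 e0.
  have [T TP] := attr x d d0.
  by exists T => sigma t Tt; rewrite traj_mlift; apply/dP/TP.
Qed.

(** * Backward iteration and invariance *)

(** The condition at time 0 is stated apart: when there is no mode there is
    no signal, and the second condition is void. *)
Lemma backward_iterP (R : realType) (n M : nat) (L : seq nat)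
    (A : 'I_M -> 'M[R]_n) S0 k y :
  backward_iter A S0 k y <->
  S0 y /\ forall sigma t, (t <= k)%N ->
    S0 (traj (fun i => liftmx L (A i)) sigma y t).
Proof.
elim: k y => [|k IH] y /=.
  by split=> [S0y|[]//]; split=> // sigma t; rewrite leqn0 => /eqP ->.
split=> [[pre S0y]|[S0y stay]]; split=> //.
  move=> sigma [//|t]; rewrite ltnS trajSr => tk.
  by have /IH[_] := pre (sigma 0%N); exact.
move=> i; apply/IH; split; first exact: (stay (fun=> i) 1%N).
move=> sigma t tk.
by have := stay (fun j => if j is j'.+1 then sigma j' else i) t.+1 tk;
  rewrite trajSr.
Qed.

Lemma mlift_lifted_constraint (R : realType) (n p : nat)
    (c : 'I_p -> mpoly n R) x :
  lifted_constraint_set c (mlift (degrees c) x) <-> constraint_set c x.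
Proof.
suff E i : meval (fun j => x j 0) (c i) =
    ((coef_vec (degrees c) (c i))^T *m mlift (degrees c) x) 0 0.
  by split=> cx i; have := cx i; rewrite E.
apply: coef_vecP; first exact: degrees_uniq.
by move=> m mc; apply/mem_degrees; exists i, m.
Qed.

(** The lifted constraints are linear with value 0 at the origin, so they hold
    on a ball whose radius is the inverse of a bound [C] on the sums of the
    absolute values of their coefficients. *)
Lemma lifted_constraint_nbhs0 (R : realType) (n p : nat)
    (c : 'I_p -> mpoly n R) :
  \forall y \near (0 : 'cV[R]_(lift_dim n (degrees c))),
    lifted_constraint_set c y.
Proof.
pose L := degrees c.
pose C := \sum_i \sum_j `|coef_vec L (c i) j 0| + 1.
have C0 : 0 < C by rewrite ltr_wpDl// sumr_ge0// => i _; rewrite sumr_ge0.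
apply/nbhs_norm0P; exists C^-1 => /=; first by rewrite invr_gt0.
move=> y /= yC i; rewrite (le_trans (ler_norm _))// mxE.
apply: (le_trans (ler_norm_sum _ _ _)).
apply: (@le_trans _ _ (\sum_j `|coef_vec L (c i) j 0| * `|y|)).
  apply: ler_sum => j _; rewrite mxE normrM ler_wpM2l// [leRHS]mx_normrE.
  exact: (le_bigmax _ _ (j, 0)).
rewrite -mulr_suml (@le_trans _ _ (C * `|y|))//.
  rewrite ler_wpM2r// /C (bigD1 i)//= -addrA lerDl addr_ge0//.
  by rewrite sumr_ge0// => k _; rewrite sumr_ge0.
by rewrite mulrC -ler_pdivlMr// div1r ltW.
Qed.

(** A stationary iterate is mapped into itself by every lifted mode, which is
    where invariance comes from.  Conversely, the points of an admissible
    invariant set lift into [B] by the covering assumption, together with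
    their whole trajectories, so they survive every backward step. *)
Lemma backward_iter_max_invariant (R : realType) (n M p : nat)
    (A : 'I_M -> 'M[R]_n) (c : 'I_p -> mpoly n R)
    (B : set 'cV[R]_(lift_dim n (degrees c))) k :
  let S := backward_iter A (B `&` lifted_constraint_set c) in
  lift_variety R n (degrees c) `&` lifted_constraint_set c `<=` B ->
  S k = S k.+1 -> max_admissible_invariant A (constraint_set c) (lower (S k)).
Proof.
move=> S B_sup Sk; split; first split.
- move=> x Sx sigma; elim=> //= t Sxt.
  have [pre _] : S k.+1 (mlift _ (traj A sigma x t)) by rewrite -Sk.
  by rewrite /lower /= -liftmxP; exact: pre.
- by move=> x /backward_iterP[[_ /mlift_lifted_constraint]].
move=> T [Tinv TX] x Tx; have TS z : T z -> (B `&` lifted_constraint_set c)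
    (mlift (degrees c) z).
  move=> /TX/mlift_lifted_constraint cz; split=> //.
  by apply: B_sup; split=> //; exists z.
apply/backward_iterP; split=> [|sigma t _]; first exact: TS.
by rewrite traj_mlift; apply/TS/Tinv.
Qed.

Theorem theorem3 (R : realType) (n M p d : nat)
  (A : 'I_M -> 'M[R]_n) (c : 'I_p -> mpoly n R)
  (d_ge1 : (1 <= d)%N)
  (c_deg : forall i m, m \in msupp (c i) -> (1 <= mdeg m <= d)%N)
  (A_stable : asymptotically_stable A)
  (X_closed : closed (constraint_set c))
  (X_bounded : bounded_set (constraint_set c))
  (X_int0 : (constraint_set c)° 0)
  (B : set 'cV[R]_(lift_dim n (degrees c)))
  (B_polytopic : polytopic B)
  (B_compact : compact B)
  (B_int0 : B° 0)
  (B_sup : lift_variety R n (degrees c) `&` lifted_constraint_set c `<=` B) :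
  let S := backward_iter A (B `&` lifted_constraint_set c) in
  exists k : nat,
    [/\ (1 <= k)%N,
        S k = S k.+1 &
        max_admissible_invariant A (constraint_set c) (lower (S k))].
Proof.
move=> S; pose L := degrees c.
have L0 : 0%N \notin L.
  by apply/mem_degrees => -[i [m [/c_deg + m0]]]; rewrite m0.
have lift_attr := lift_uniformly_attracted (degrees_uniq c) L0
  (fun x => asymptotically_stable_uniform x A_stable).
have [K0 [_ /(_ (K0 + 1))]] := compact_bounded B_compact.
rewrite ltrDl ltr01 => /(_ isT) BK.
have S0_nbhs : nbhs (0 : 'cV[R]_(lift_dim n L))
    (B `&` lifted_constraint_set c).
  by apply: filterI => //; exact: lifted_constraint_nbhs0.
have [T TP] := uniform_absorption (K0 + 1) lift_attr S0_nbhs.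
(* [S T = S T.+1] holds as well; the shift ensures that the index is positive. *)
have ST : S T.+1 = S T.+2.
  apply/seteqP; split=> y /backward_iterP[S0y stay]; apply/backward_iterP.
    split=> // sigma t _; have [tT|Tt] := leqP t T; first exact/stay/ltnW.
    by apply: TP; [apply: BK; case: S0y|exact: ltnW].
  by split=> // sigma t tT; apply/stay/ltnW.
by exists T.+1; split=> //; exact: backward_iter_max_invariant.
Qed.
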